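(* Consider the (reformulated) Bolthausen–Kistler generalized random energy model described in the context, with weights $a_s\ge0$, $s\in S$, where $S$ is the set of non-empty subsets of $I=\{1,\dots,n\}$, with $\frac{k(i,N)}N\to p_i>0$ for $1\le i\le n$, and where for each $s\in S$ the laws $\{\lambda_N^s:N\ge n\}$ of the driving variables satisfy the large deviation principle with a good convex rate function $\mathcal{I}_s$. Then almost surely, for $\beta>0$, $$\lim_{N\to\infty}\frac1N\log Z_N(\beta)=\log2-\inf_{\widetilde x\in\Psi}\sum_{s\in S}\left(\beta a_sx_s+\mathcal{I}_s(x_s)\right),$$ where $$\Psi=\left\{\widetilde x=(x_s)_{s\in S}\in\mathbb{R}^S:\ \sum_{s\in S,\,s\subseteq t}\mathcal{I}_s(x_s)\le\sum_{i\in t}p_i\log2\ \text{ for all }t\in S\right\}.$$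
   Context: Model: fix $n\ge1$. For each $N\ge n$ let $k(1,N),\dots,k(n,N)\ge1$ be integers with sum $N$. Write $\sigma\in\{+1,-1\}^N$ as $\sigma=\sigma_1\cdots\sigma_n$ with $\sigma_i\in\{+1,-1\}^{k(i,N)}$. For $s=\{i_1<\cdots<i_k\}\in S$ let $\sigma(s)=\sigma_{i_1}\cdots\sigma_{i_k}\in\prod_{i\in s}\{+1,-1\}^{k(i,N)}$. For each $N$ there are independent real random variables $\xi(s,\sigma(s))$, one for each $s\in S$ and each possible value of $\sigma(s)$, with $\xi(s,\sigma(s))$ having law $\lambda_N^s$; all $N$ on one probability space. $H_N(\sigma)=N\sum_{s\in S}a_s\,\xi(s,\sigma(s))$ and $Z_N(\beta)=\sum_{\sigma\in\{+1,-1\}^N}e^{-\beta H_N(\sigma)}$. LDP: probability measures $\{\nu_N\}$ on $\mathbb{R}$ satisfy the LDP with rate function $\mathcal{I}:\mathbb{R}\to[0,\infty]$ (lower semicontinuous) if $-\inf_{B^0}\mathcal{I}\le\liminf_N\frac1N\log\nu_N(B)\le\limsup_N\frac1N\log\nu_N(B)\le-\inf_{\overline B}\mathcal{I}$ for all Borel $B$; good means compact level sets $\{\mathcal{I}\le a\}$, $a<\infty$. *)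

(* Defs.v *)
From HB Require Import structures.
From mathcomp Require Import all_boot all_order all_algebra.
From mathcomp Require Import all_classical all_reals all_analysis.

Set Implicit Arguments.
Unset Strict Implicit.
Unset Printing Implicit Defensive.

Import Order.TTheory GRing.Theory Num.Theory.
Import numFieldNormedType.Exports.

Local Open Scope classical_set_scope.
Local Open Scope ring_scope.

Section LargeDeviations.
Context {R : realType}.
Local Open Scope ereal_scope.

(* [lne 0 = -oo] and [ereal_inf set0 = +oo]; the index [N = 0] is irrelevant
   to the limits. *)
Definition LDP (nu : nat -> probability R R)
    (J : R -> \bar R) : Prop :=
  [/\ (forall x, 0 <= J x),
      lower_semicontinuous J
    & forall B : set R, measurable B ->
      [/\ - ereal_inf (J @` B°) <=
            limn_einf (fun N => (N%:R^-1)%:E * lne (nu N B)),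
          limn_einf (fun N => (N%:R^-1)%:E * lne (nu N B)) <=
            limn_esup (fun N => (N%:R^-1)%:E * lne (nu N B))
        & limn_esup (fun N => (N%:R^-1)%:E * lne (nu N B)) <=
            - ereal_inf (J @` closure B)]].

Definition good_rate (J : R -> \bar R) : Prop :=
  forall a : R, compact [set x | J x <= a%:E].

(* At the end points [t = 0, 1] the library convention [0 * +oo = 0] makes the
   inequality trivial. *)
Definition convex_rate (J : R -> \bar R) : Prop :=
  forall (x y t : R), (0 <= t <= 1)%R ->
    J (t * x + (1 - t) * y)%R <= t%:E * J x + (1 - t)%:E * J y.

Definition mutually_independent d (T : measurableType d)
    (P : probability T R) (U : finType) (X : U -> {RV P >-> R}) : Prop :=
  forall (V : {set U}) (B : U -> set R), (forall u, measurable (B u)) ->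
    P (\bigcap_(u in [set` V]) (X u @^-1` B u)) =
    \prod_(u in V) P (X u @^-1` B u).

End LargeDeviations.

Section Model.
Variable n : nat.

(* The set S of non-empty subsets of I; the i-th element of I is the i-th
   element of ['I_n]. *)
Definition neset : finType := {s : {set 'I_n} | s != finset.set0}.

(* For block lengths k with sum N, [config k] is {+1,-1}^N written as the
   product of the blocks {+1,-1}^(k i), with [true] for +1 and [false] for -1
   (the numerical value of a spin is never used). *)
Definition config (k : 'I_n -> nat) : finType :=
  {dffun forall i : 'I_n, (k i).-tuple bool}.

Definition subconfig (k : 'I_n -> nat) (s : neset) : finType :=
  {dffun forall i : {i : 'I_n | i \in val s}, (k (val i)).-tuple bool}.

Definition proj_config (k : 'I_n -> nat) (s : neset) (sigma : config k) :
    subconfig k s :=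
  [ffun i : {i : 'I_n | i \in val s} => sigma (val i)].

Context {R : realType}.

(* [xi] is one realisation of the driving variables at size N. *)
Definition hamiltonian (k : 'I_n -> nat) (a : neset -> R) (N : nat)
    (xi : forall s : neset, subconfig k s -> R) (sigma : config k) : R :=
  N%:R * \sum_(s : neset) a s * xi s (proj_config s sigma).

Definition partition_function (k : 'I_n -> nat) (a : neset -> R) (N : nat)
    (xi : forall s : neset, subconfig k s -> R) (beta : R) : R :=
  \sum_(sigma : config k) expR (- beta * hamiltonian a N xi sigma).

Definition Psi (p : 'I_n -> R) (J : neset -> R -> \bar R) :
    set (neset -> R) :=
  [set x | forall t : neset,
    (\sum_(s : neset | val s \subset val t) J s (x s) <=
     (\sum_(i in val t) p i * ln 2)%:E)%E].

End Model.

(* Main.v *)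
Require Import Defs.
From HB Require Import structures.
From mathcomp Require Import all_boot all_order all_algebra.
From mathcomp Require Import all_classical all_reals all_analysis.
From mathcomp Require Import measurable_realfun ring lra zify.

Set Implicit Arguments.
Unset Strict Implicit.
Unset Printing Implicit Defensive.

Import Order.TTheory GRing.Theory Num.Theory.
Import numFieldNormedType.Exports.

Local Open Scope classical_set_scope.
Local Open Scope ring_scope.

(** Why the theorem is true.  A spin configuration contributes to the partition
    function through the vector of the driving variables attached to its
    restrictions, so everything is decided by how many configurations have
    their vector near a given point x.  Let every x_s be confined to a small
    interval B_s.  A restricted configuration on the blocks of t has about
    exp(N (entropy t)) values, and each of them sees all its variables indexed
    by s inside t fall in the B_s with probability about
    exp(-N sum_(s inside t) J_s(x_s)).

    Upper bound.  By the first moment ([occupation_le]) the number of such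
    restrictions is at most exp(N (entropy t - sum_(s inside t) J_s(x_s))) up
    to a small error.  If that exponent is negative for one t, there is
    eventually no such restriction, hence no such configuration, and the box
    around x can be ignored.  The boxes that survive contain a point of [Psi],
    because good rate functions attain their infimum on closed sets
    ([occupied_cells]).  Goodness also makes the driving variables bounded, so
    finitely many boxes carry the whole partition function ([partition_upper]).

    Lower bound.  Two configurations that agree exactly on the blocks of t share
    the variables indexed by the s inside t and are otherwise independent.  So
    the relative variance of the number of configurations in a box is at most
    the sum over nonempty t of the inverse expected number of occupied
    restrictions to t ([relative_variance_le]), which is exponentially small as
    soon as all the inequalities defining [Psi] are strict ([occupation_ge]).
    Convexity allows one to make them strict: move a point of [Psi] slightly
    towards a common zero of the rate functions ([partition_lower]).

    Both bounds fail with summable probability, so Borel-Cantelli applies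
    ([ae_eventually_not]); boxes are taken from a countable grid so that one
    null set serves all x and all inverse temperatures at once.

    At fixed N only finitely many events matter, so expectations are finite sums
    over the possible patterns of occurrence of these events. *)

(** * Moments of counts of independent events *)
Section FinitePatterns.
Context {R : realType} d (T : measurableType d) (P : probability T R).
Context (U : finType) (A : U -> set T).
Hypothesis mA : forall u, measurable (A u).

Definition pattern (w : T) : {set U} := finset (fun u => w \in A u).

Definition pattern_weight (v : {set U}) : R := fine (P (pattern @^-1` [set v])).

Lemma measurable_pattern1 (v : {set U}) : measurable (pattern @^-1` [set v]).
Proof.
have -> : pattern @^-1` [set v] =
    \bigcap_(u in [set: U]) (if u \in v then A u else ~` A u).
  apply/seteqP; split => [w <- u _|w wA].
    rewrite /pattern inE; case: ifPn => [/set_mem //|]; first by rewrite notin_setE.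
  apply/setP => u; have := wA u I; rewrite /pattern inE.
  case: ifPn => _ Au; first exact/mem_set.
  by apply/negbTE; rewrite notin_setE.
apply: fin_bigcap_measurable => // u _; case: ifPn => // _.
exact: measurableC.
Qed.

Lemma pattern_preimageE (F : pred {set U}) :
  [set w | F (pattern w)] = \bigcup_(v in [set` F]) (pattern @^-1` [set v]).
Proof.
apply/seteqP; split => [w Fw|w [v Fv /= ->] //].
by exists (pattern w).
Qed.

Lemma measurable_pattern (F : pred {set U}) : measurable [set w | F (pattern w)].
Proof.
rewrite pattern_preimageE; apply: fin_bigcup_measurable => // v _.
exact: measurable_pattern1.
Qed.

Lemma pattern_weight_ge0 v : 0 <= pattern_weight v.
Proof. exact/fine_ge0. Qed.

Lemma probability_pattern (F : pred {set U}) :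
  P [set w | F (pattern w)] = (\sum_(v | F v) pattern_weight v)%:E.
Proof.
rewrite pattern_preimageE measure_fin_bigcup//; first last.
- by move=> v _; exact: measurable_pattern1.
- by apply/trivIsetP => u v _ _ uv; apply/seteqP; split => // w /= [-> /eqP]; rewrite (negPf uv).
rewrite (fsbigE [seq v <- index_enum {set U} | F v]) ?filter_uniq ?index_enum_uniq//; first last.
- by move=> v Fv; rewrite mem_filter mem_index_enum andbT => /negP.
- by move=> v /=; rewrite mem_filter => /andP[].
rewrite big_filter_cond -sumEFin; apply: eq_big => v.
  by apply/andb_idr => Fv; exact/mem_set.
move=> _; rewrite fineK// fin_num_measure//; exact: measurable_pattern1.
Qed.

Section Moments.
Variable q : U -> R.
Hypothesis indepA : forall W : {set U},
  P (\bigcap_(u in [set` W]) A u) = (\prod_(u in W) q u)%:E.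

(** The only way independence enters: the probability that all the events indexed
    by W occur is a sum of pattern weights, so every moment below becomes a sum
    of products of the [q u]. *)
Lemma sum_pattern_weight_superset (W : {set U}) :
  \sum_(v : {set U} | W \subset v) pattern_weight v = \prod_(u in W) q u.
Proof.
apply: EFin_inj; rewrite -indepA -(probability_pattern (fun v => W \subset v)).
congr (P _); apply/seteqP; split => w /=.
  by move=> /fintype.subsetP Ww u /= /Ww; rewrite inE => /set_mem.
by move=> wW; apply/fintype.subsetP => u uW; rewrite inE; apply/mem_set/wW.
Qed.

Context (I : finType) (D : pred I) (G : I -> {set U}).

Definition hits (v : {set U}) : R := \sum_(i | D i) (G i \subset v)%:R.

Lemma expectation_hits :
  \sum_v pattern_weight v * hits v = \sum_(i | D i) \prod_(u in G i) q u.
Proof.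
under eq_bigr do rewrite mulr_sumr.
rewrite exchange_big; apply: eq_bigr => i _ /=.
rewrite -sum_pattern_weight_superset [RHS]big_mkcond /=.
by apply: eq_bigr => v _; case: ifP; rewrite ?mulr1 ?mulr0.
Qed.

(** [G i] and [G j] are both inside a pattern iff their union is, so events shared
    by [i] and [j] are paid for once: this is where correlations come from. *)
Lemma second_moment_hits :
  \sum_v pattern_weight v * hits v ^+ 2 =
  \sum_(i | D i) \sum_(j | D j) \prod_(u in G i :|: G j) q u.
Proof.
under eq_bigr => v _.
  rewrite expr2 /hits mulr_suml mulr_sumr.
  under eq_bigr do rewrite !mulr_sumr.
  over.
rewrite exchange_big; apply: eq_bigr => i _ /=.
rewrite exchange_big; apply: eq_bigr => j _ /=.
rewrite -sum_pattern_weight_superset [RHS]big_mkcond /=.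
apply: eq_bigr => v _; rewrite finset.subUset.
by case: (G i \subset v); case: (G j \subset v); rewrite /= ?mulr1 ?mulr0.
Qed.

Lemma hits_markov (y : R) : 0 < y ->
  (P [set w | (y <= hits (pattern w))%R] <=
   ((\sum_(i | D i) \prod_(u in G i) q u) / y)%:E)%E.
Proof.
move=> y0; rewrite (probability_pattern (fun v => y <= hits v)) lee_fin.
rewrite ler_pdivlMr// mulr_suml -expectation_hits [leRHS](bigID (fun v => y <= hits v)) /=.
rewrite -[leLHS]addr0 lerD//.
  by apply: ler_sum => v yv; rewrite ler_wpM2l// pattern_weight_ge0.
apply: sumr_ge0 => v _; rewrite mulr_ge0 ?pattern_weight_ge0//.
exact: sumr_ge0.
Qed.

Lemma sum_pattern_weight : \sum_v pattern_weight v = 1.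
Proof.
apply: EFin_inj; rewrite -(probability_pattern xpredT) -(probability_setT P).
by congr (P _); apply/seteqP; split.
Qed.

(** The right-hand side is four times the relative variance: on the event, the
    deviation from the mean [m] is at least [m / 2]. *)
Lemma hits_chebyshev (m : R) : m = \sum_(i | D i) \prod_(u in G i) q u -> 0 < m ->
  (P [set w | (hits (pattern w) <= m / 2)%R] <=
   (4 * ((\sum_(i | D i) \sum_(j | D j) \prod_(u in G i :|: G j) q u) / m ^+ 2 - 1))%:E)%E.
Proof.
move=> mE m0; rewrite (probability_pattern (fun v => hits v <= m / 2)) lee_fin.
have -> : (\sum_(i | D i) \sum_(j | D j) \prod_(u in G i :|: G j) q u) / m ^+ 2 - 1 =
    \sum_v pattern_weight v * ((hits v - m) / m) ^+ 2.
  under [RHS]eq_bigr => v _.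
    have -> : pattern_weight v * ((hits v - m) / m) ^+ 2 =
      (pattern_weight v * hits v ^+ 2) * m ^- 2 +
      ((pattern_weight v * hits v) * (- 2 * m^-1) + pattern_weight v).
      by field; exact: lt0r_neq0.
    over.
  rewrite !big_split /= -!mulr_suml second_moment_hits expectation_hits -mE sum_pattern_weight.
  by field; exact: lt0r_neq0.
rewrite mulr_sumr [leRHS](bigID (fun v => hits v <= m / 2)) /=.
rewrite -[leLHS]addr0 lerD//.
  apply: ler_sum => v yv; rewrite mulrCA -[leLHS]mulr1 ler_wpM2l ?pattern_weight_ge0//.
  have : (hits v - m) / m <= - 2^-1 by rewrite ler_pdivrMr//; lra.
  by move: (_ / m) => x; nra.
apply: sumr_ge0 => v _; rewrite mulr_ge0// mulr_ge0 ?pattern_weight_ge0 ?sqr_ge0//.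
Qed.

End Moments.
End FinitePatterns.

(** * Configurations, their restrictions and their overlaps *)
Section Counting.
Variables (n : nat) (k : 'I_n -> nat).

Local Notation bond := {s : neset n & subconfig k s}.

Definition block_size (t : {set 'I_n}) : nat := (\sum_(i in t) k i)%N.

Definition agreement (sigma sigma' : config k) : {set 'I_n} :=
  finset (fun i => sigma i == sigma' i).

Definition plus_config : config k := [ffun i => nseq_tuple (k i) true].

(** The spins off [t] are frozen to a reference value, so that anchored
    configurations are representatives of the restrictions to the blocks of [t]
    and can be handled inside the single type [config k]. *)
Definition anchored (t : {set 'I_n}) : pred (config k) :=
  fun sigma => finset.setC t \subset agreement plus_config sigma.

(** The indices of the driving variables seen by the restriction of a
    configuration to the blocks of [t]. *)
Definition bonds (t : {set 'I_n}) (sigma : config k) : {set bond} :=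
  [set Tagged (subconfig k) (proj_config s sigma) | s in [pred s : neset n | val s \subset t]]%SET.

Lemma proj_config_eq (s : neset n) (sigma sigma' : config k) :
  (proj_config s sigma == proj_config s sigma') =
  (val s \subset agreement sigma sigma').
Proof.
apply/eqP/fintype.subsetP => [e i si|sa].
  have := congr1 (fun f : subconfig k s => f (Sub i si)) e.
  by rewrite /proj_config !ffunE/= inE => ->.
by apply/ffunP => i; rewrite !ffunE; apply/eqP; have := sa _ (valP i); rewrite inE.
Qed.

Lemma card_agreement (t : {set 'I_n}) (sigma : config k) :
  #|[pred sigma' | t \subset agreement sigma sigma']| = (2 ^ block_size (finset.setC t))%N.
Proof.
pose F (i : 'I_n) : pred ((k i).-tuple bool) :=
  fun x => (i \in t) ==> (sigma i == x).
rewrite (_ : #|_| = #|(family F : simpl_pred (config k))|); last first.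
  apply: eq_card => sigma'; rewrite inE; apply/fintype.subsetP/familyP => h i.
    by rewrite unfold_in; apply/implyP => /h; rewrite inE.
  by move=> it; move/implyP: (h i) => /(_ it) e; rewrite inE.
rewrite card_family /block_size.
have cF i : #|F i| = (if i \notin t then 2 ^ k i else 1)%N.
  case: (boolP (i \in t)) => it /=.
    rewrite -(card1 (sigma i)).
    by apply: eq_card => x; rewrite !inE unfold_in /F it /= eq_sym.
  rewrite -card_bool -card_tuple; apply: eq_card => x.
  by rewrite !inE unfold_in /F (negbTE it).
rewrite /image_mem (eq_map cF) foldrE big_map -big_mkcond /=.
rewrite (big_morph (fun m => 2 ^ m)%N (expnD 2) (expn0 2)) big_enum_cond /=.
by apply: eq_bigl => i; rewrite inE.
Qed.

Lemma block_size_setC t : (block_size t + block_size (finset.setC t) = block_size finset.setT)%N.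
Proof.
rewrite /block_size [RHS](bigID (mem t)) /=; congr addn; apply: eq_bigl => i;
  by rewrite !inE.
Qed.

Context {R : realType} (q : neset n -> R).

Lemma prod_bonds t sigma :
  \prod_(u in bonds t sigma) q (tag u) = \prod_(s : neset n | val s \subset t) q s.
Proof.
rewrite /bonds big_imset//=.
by move=> s s' _ _ /(congr1 (fun u => tag u)).
Qed.

(** Configurations share the variable of index [s] iff they agree on all the blocks
    of [s]; the second one only brings the variables on which they differ. *)
Lemma prod_bondsU sigma sigma' :
  \prod_(u in bonds finset.setT sigma :|: bonds finset.setT sigma') q (tag u) =
  (\prod_s q s) * \prod_(s : neset n | ~~ (val s \subset agreement sigma sigma')) q s.
Proof.
pose H : {set bond} := [set Tagged (subconfig k) (proj_config s sigma')
  | s in [pred s : neset n | ~~ (val s \subset agreement sigma sigma')]]%SET.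
have -> : bonds finset.setT sigma :|: bonds finset.setT sigma' =
    bonds finset.setT sigma :|: H.
  apply/setP => u; rewrite !finset.in_setU; apply/orP/orP => [[->|]|[->|]]; try by left.
    move=> /imsetP[s _ ->].
    have [sa|sa] := boolP (val s \subset agreement sigma sigma').
      left; apply/imsetP; exists s; rewrite ?inE ?finset.subsetT//.
      by move: sa; rewrite -proj_config_eq => /eqP ->.
    by right; apply/imsetP; exists s.
  move=> /imsetP[s _ ->].
  by right; apply/imsetP; exists s; rewrite ?inE ?finset.subsetT.
rewrite (eq_bigl [predU bonds finset.setT sigma & H]); last by move=> u; rewrite !inE.
rewrite bigU /=; last first.
  rewrite -setI_eq0; apply/eqP/setP => u; rewrite !inE.
  apply/negP => /andP[/imsetP[s _ ->] /imsetP[s']].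
  rewrite inE -proj_config_eq => + e.
  have es := congr1 (fun u => tag u) e; rewrite /= in es; subst s'.
  by move: e => /eqP; rewrite eq_Tagged/= => ->.
congr (_ * _).
  by rewrite prod_bonds; apply: eq_bigl => s; rewrite finset.subsetT.
rewrite /H big_imset//=.
by move=> s s' _ _ /(congr1 (fun u => tag u)).
Qed.

Lemma card_anchored t : #|anchored t| = (2 ^ block_size t)%N.
Proof.
rewrite -[in RHS](finset.setCK t) -(card_agreement _ plus_config).
by apply: eq_card.
Qed.

Lemma card_config : #|config k| = (2 ^ block_size finset.setT)%N.
Proof.
rewrite -finset.setC0 -(card_agreement _ plus_config).
by apply: eq_card => sigma; rewrite !inE finset.sub0set.
Qed.

Lemma sum_prod_bonds t :
  \sum_(sigma | anchored t sigma) \prod_(u in bonds t sigma) q (tag u) =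
  2 ^+ block_size t * \prod_(s : neset n | val s \subset t) q s.
Proof.
transitivity (\sum_(sigma | anchored t sigma) \prod_(s : neset n | val s \subset t) q s).
  by apply: eq_bigr => sigma _; rewrite prod_bonds.
by rewrite sumr_const card_anchored -[LHS]mulr_natl natrX.
Qed.

(** Bound the weight of a pair agreeing on exactly [t] by the sum of the weights of
    all subsets of its agreement set: exact agreement need not be counted any
    more, and the pairs agreeing at least on [t] are a fraction
    [2 ^- block_size t] of all pairs.  The term of the empty set is 1 and cancels
    the [- 1]. *)
Lemma relative_variance_le : (forall s, 0 < q s) ->
  (\sum_(sigma : config k) \sum_(sigma' : config k)
     \prod_(u in bonds finset.setT sigma :|: bonds finset.setT sigma') q (tag u))
    / (2 ^+ block_size finset.setT * \prod_s q s) ^+ 2 - 1 <=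
  \sum_(t : {set 'I_n} | t != finset.set0)
    (2 ^+ block_size t * \prod_(s : neset n | val s \subset t) q s)^-1.
Proof.
move=> q0; rewrite lerBlDl.
pose K := block_size finset.setT.
pose Q := \prod_s q s.
have Q0 : 0 < Q by exact: prodr_gt0.
pose w (t : {set 'I_n}) := (\prod_(s : neset n | val s \subset t) q s)^-1.
have w0 t : 0 < w t by rewrite invr_gt0 prodr_gt0.
have e2 : 2 ^+ K != 0 :> R by rewrite expf_eq0/= pnatr_eq0 andbF.
have -> : (\sum_(sigma : config k) \sum_(sigma' : config k)
    \prod_(u in bonds finset.setT sigma :|: bonds finset.setT sigma') q (tag u))
    / (2 ^+ K * Q) ^+ 2 =
    2 ^- K * 2 ^- K * \sum_(sigma : config k) \sum_(sigma' : config k) w (agreement sigma sigma').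
  rewrite !mulr_sumr mulr_suml; apply: eq_bigr => sigma _.
  rewrite !mulr_sumr mulr_suml; apply: eq_bigr => sigma' _.
  rewrite prod_bondsU -/Q /w.
  have -> : Q = \prod_(s : neset n | val s \subset agreement sigma sigma') q s *
      \prod_(s : neset n | ~~ (val s \subset agreement sigma sigma')) q s.
    by rewrite /Q (bigID (fun s : neset n => val s \subset agreement sigma sigma')).
  have h (F : pred (neset n)) : \prod_(s | F s) q s != 0.
    by rewrite gt_eqF// prodr_gt0.
  by field; rewrite ?e2 ?h.
(* Only the term of index [agreement sigma sigma'] is needed for this bound. *)
have le_w sigma sigma' : w (agreement sigma sigma') <=
    \sum_(t : {set 'I_n} | t \subset agreement sigma sigma') w t.
  rewrite (bigD1 (agreement sigma sigma'))//= lerDl sumr_ge0// => t _.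
  exact: ltW.
have -> : 1 + \sum_(t : {set 'I_n} | t != finset.set0)
    (2 ^+ block_size t * \prod_(s : neset n | val s \subset t) q s)^-1 =
    \sum_(t : {set 'I_n}) 2 ^- block_size t * w t.
  rewrite [RHS](bigD1 finset.set0)//=; congr (_ + _); last first.
    by apply: eq_bigr => t _; rewrite invfM.
  rewrite /w /block_size big_set0 expr0 invr1 mul1r big_pred0 ?invr1// => s.
  by rewrite finset.subset0 (negbTE (valP s)).
have -> : \sum_(t : {set 'I_n}) 2 ^- block_size t * w t =
    2 ^- K * 2 ^- K * \sum_(sigma : config k) \sum_(sigma' : config k)
    \sum_(t : {set 'I_n} | t \subset agreement sigma sigma') w t.
  under [in RHS]eq_bigr => sigma _.
    rewrite (exchange_big_dep xpredT)//=.
    under eq_bigr => t _.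
      rewrite sumr_const card_agreement; over.
    over.
  rewrite sumr_const card_config -/K -sumrMnl mulr_sumr; apply: eq_bigr => t _.
  have mulrnn (x : R) a b : x *+ (2 ^ a) *+ (2 ^ b) = x * 2 ^+ a * 2 ^+ b.
    by rewrite -[LHS]mulr_natr -[x *+ _]mulr_natr !natrX.
  rewrite mulrnn /K -(block_size_setC t) exprD.
  have e m : 2 ^+ m != 0 :> R by rewrite expf_eq0/= pnatr_eq0 andbF.
  by field; rewrite !e.
by rewrite ler_wpM2l ?mulr_ge0 ?invr_ge0 ?exprn_ge0// ler_sum// => sigma _; exact: ler_sum.
Qed.

Section OccupationNumber.
Variables (x : forall s : neset n, subconfig k s -> R) (B : neset n -> set R).
Arguments x : clear implicits.

Definition occupied : {set bond} :=
  finset (fun u : bond => x (tag u) (tagged u) \in B (tag u)).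

(** The number of restrictions to the blocks of [t] all of whose variables, for [s]
    inside [t], lie in the windows [B s]. *)
Definition occupation (t : {set 'I_n}) : R := hits (anchored t) (bonds t) occupied.

Lemma bonds_subset_occupied (t : {set 'I_n}) (sigma : config k) :
  reflect (forall s : neset n, val s \subset t -> B s (x s (proj_config s sigma)))
    (bonds t sigma \subset occupied).
Proof.
apply: (iffP fintype.subsetP) => [h s st|h u /imsetP[s]].
  have : Tagged (subconfig k) (proj_config s sigma) \in bonds t sigma.
    by apply/imsetP; exists s.
  by move/h; rewrite inE => /set_mem.
by rewrite inE => /h st ->; rewrite inE; exact/mem_set.
Qed.

(** A configuration that is not anchored still counts, through the anchored
    configuration with the same restriction to [t]. *)
Lemma occupation_ge1 (t : {set 'I_n}) (sigma : config k) :
  (forall s : neset n, val s \subset t -> B s (x s (proj_config s sigma))) ->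
  1 <= occupation t.
Proof.
move=> h; pose tau : config k := [ffun i => if i \in t then sigma i else plus_config i].
have tauA : anchored t tau.
  by apply/fintype.subsetP => i; rewrite !inE [tau i]ffunE => /negbTE ->.
rewrite /occupation /hits (bigD1 tau)//= (_ : _ \subset _) ?lerDl ?sumr_ge0//.
apply/bonds_subset_occupied => s st.
suff -> : proj_config s tau = proj_config s sigma by exact: h.
apply/eqP; rewrite proj_config_eq; apply/fintype.subsetP => i si.
by rewrite inE [tau i]ffunE (fintype.subsetP st).
Qed.

End OccupationNumber.

End Counting.

(** * Almost sure statements *)
Section BorelCantelli.
Context {R : realType} d (T : measurableType d) (P : probability T R).

(** Borel-Cantelli with exponentially small probabilities, whose sum is bounded by
    a geometric series. *)
Lemma ae_eventually_not (E : nat -> set T) (C r : R) : 0 <= C -> 0 < r ->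
  (\forall N \near \oo, measurable (E N) /\
     (P (E N) <= (C * expR (- (r * N%:R)))%:E)%E) ->
  {ae P, forall w, \forall N \near \oo, ~ E N w}.
Proof.
move=> C0 r0 [N0 _ hN].
pose F j := E (j + N0)%N.
have mF j : measurable (F j) by have [] := hN _ (leq_addl j N0).
pose z := expR (- r).
have z0 : 0 < z by exact: expR_gt0.
have z1 : z < 1 by rewrite /z -[ltRHS]expR0 ltr_expR oppr_lt0.
have PF j : (P (F j) <= (C * z ^+ j)%:E)%E.
  have [_ /le_trans] := hN _ (leq_addl j N0); apply.
  rewrite lee_fin ler_wpM2l// /z -expRM_natl ler_expR natrD.
  have : 0 <= r * N0%:R by rewrite mulr_ge0// ltW.
  by rewrite mulrN; lra.
have sum_fin : (\sum_(j <oo) P (F j) < +oo)%E.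
  apply: (@le_lt_trans _ _ (C / (1 - z))%:E); last exact: ltry.
  apply: lime_le; first by apply: is_cvg_nneseries => j _ _; exact: measure_ge0.
  apply: nearW => m; apply: (@le_trans _ _ (\sum_(0 <= j < m) (C * z ^+ j)%:E)%E).
    by apply: lee_sum => j _.
  rewrite sumEFin lee_fin -mulr_sumr ler_wpM2l// big_mkord.
  have := subrX1 z m; have : 0 <= z ^+ m by rewrite exprn_ge0// ltW.
  by move=> zm e; rewrite -[leRHS]mul1r ler_pdivlMr ?subr_gt0//; nra.
exists (lim_sup_set F); split.
- by apply: bigcap_measurable => // j _; apply: bigcup_measurable.
- exact: lim_sup_set_cvg0.
- move=> w /= nw j _; apply: contrapT => hj; apply: nw.
  exists (j + N0)%N => // N /= jN EN; apply: hj.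
  exists (N - N0)%N => /=; first by rewrite leq_subRL ?(leq_trans (leq_addl _ _) jN)// addnC.
  by rewrite /F subnK// (leq_trans (leq_addl _ _) jN).
Qed.

Lemma ae_forall_countable (I : countType) (Q : I -> T -> Prop) :
  (forall i, {ae P, forall w, Q i w}) -> {ae P, forall w, forall i, Q i w}.
Proof.
move=> aeQ.
pose Q' m w := if unpickle m is Some i then Q i w else True.
have : {ae P, forall w, forall m, Q' m w}.
  apply: ae_foralln => m; rewrite /Q'.
  by case: unpickle => [i|]; [exact: aeQ|exact: nearW].
by apply: filterS => w Qw i; have := Qw (pickle i); rewrite /Q' pickleK.
Qed.

End BorelCantelli.

(** * Exponential bounds on occupation numbers *)
Section Occupation.
Context {R : realType} (n : nat) (k : nat -> 'I_n -> nat).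
Hypothesis hksum : forall N, (n <= N)%N -> (\sum_(i < n) k N i)%N = N.
Variable p : 'I_n -> R.
Hypothesis hkp : forall i, (fun N : nat => (k N i)%:R / N%:R : R) @ \oo --> p i.

(** The exponential growth rate of the number of restrictions to the blocks
    of [t]. *)
Definition entropy (t : {set 'I_n}) : R := \sum_(i in t) p i * ln 2.

Lemma block_entropy (t : {set 'I_n}) (e : R) : 0 < e -> \forall N \near \oo,
  expR (N%:R * (entropy t - e)) <= 2 ^+ block_size (k N) t :> R /\
  2 ^+ block_size (k N) t <= expR (N%:R * (entropy t + e)) :> R.
Proof.
move=> e0.
have ct : (fun N : nat => \sum_(i in t) (k N i)%:R / N%:R * ln 2 : R) @ \oo --> entropy t.
  apply: (cvg_big add_continuous) => i _; by apply: cvgM; [exact: hkp|exact: cvg_cst].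
move/cvgrPdist_lt: ct => /(_ _ e0); apply: filterS2 (nbhs_infty_gt 0) => N N0.
have -> : \sum_(i in t) (k N i)%:R / N%:R * ln 2 = ln 2 *+ block_size (k N) t / N%:R :> R.
  rewrite -[ln 2 *+ _]mulr_natl /block_size natr_sum !mulr_suml; apply: eq_bigr => i _; lra.
rewrite -[2 ^+ _ : R](@lnK R) ?posrE ?exprn_gt0// lnXn// !ler_expR.
have N0' : 0 < N%:R :> R by rewrite ltr0n.
rewrite ltr_distlC => /andP[]; rewrite ltr_pdivlMr// ltr_pdivrMr// => /ltW h1 /ltW h2.
by split; rewrite mulrC.
Qed.

Lemma entropyT : entropy finset.setT = ln 2.
Proof.
have ct : (fun N : nat => \sum_(i in finset.setT) (k N i)%:R / N%:R * ln 2 : R) @ \oo -->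
    entropy finset.setT.
  apply: (cvg_big add_continuous) => i _; by apply: cvgM; [exact: hkp|exact: cvg_cst].
rewrite -(cvg_lim (@Rhausdorff R) ct); apply: (cvg_lim (@Rhausdorff R)).
apply: cvg_near_cst.
near=> N.
rewrite -!mulr_suml -natr_sum (eq_bigl xpredT) => [|i]; last by rewrite inE.
rewrite hksum; last by near: N; exact: nbhs_infty_ge.
rewrite divff ?mul1r// pnatr_eq0 -lt0n; near: N; exact: nbhs_infty_gt.
Unshelve. all: by end_near. Qed.


Variable lambda : neset n -> nat -> probability R R.
Context (d : measure_display) (T : measurableType d) (P : probability T R).
Variable xi : forall (N : nat) (s : neset n), subconfig (k N) s -> {RV P >-> R}.
Arguments xi : clear implicits.
Hypothesis hlaw : forall N, (n <= N)%N ->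
  forall (s : neset n) (tau : subconfig (k N) s) (B : set R),
  measurable B -> distribution P (xi N s tau) B = lambda s N B.
Hypothesis hindep : forall N, (n <= N)%N ->
  mutually_independent (fun u : {s : neset n & subconfig (k N) s} =>
    xi N (tag u) (tagged u)).

Variable B : neset n -> set R.
Hypothesis mB : forall s, measurable (B s).

Definition hit_event (N : nat) (u : {s : neset n & subconfig (k N) s}) : set T :=
  xi N (tag u) (tagged u) @^-1` B (tag u).

Local Notation occupation_at t N w :=
  (occupation (fun s tau => xi N s tau w) B t).

Definition hit_prob (N : nat) (s : neset n) : R := fine (lambda s N (B s)).

Lemma measurable_hit_event N u : measurable (@hit_event N u).
Proof. by rewrite /hit_event; exact: measurable_funPTI. Qed.

Lemma hit_event_indep N : (n <= N)%N ->
  forall W : {set {s : neset n & subconfig (k N) s}},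
  P (\bigcap_(u in [set` W]) @hit_event N u) = (\prod_(u in W) hit_prob N (tag u))%:E.
Proof.
move=> nN W; have := hindep nN W (fun u => mB (tag u)).
rewrite /hit_event => ->; rewrite -prodEFin; apply: eq_bigr => u _.
by rewrite /hit_prob fineK ?fin_num_measure// -(hlaw nN (tagged u)).
Qed.

(** Markov: the expected occupation number has the stated exponent without [e], up
    to the subexponential error on the block sizes, which takes [e / 2]. *)
Lemma occupation_le (t : {set 'I_n}) (c : neset n -> R) (e : R) : 0 < e ->
  (forall s : neset n, val s \subset t ->
    \forall N \near \oo, hit_prob N s <= expR (- (N%:R * c s))) ->
  {ae P, forall w, \forall N \near \oo,
    occupation_at t N w <=
    expR (N%:R * (entropy t - \sum_(s : neset n | val s \subset t) c s + e))}.
Proof.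
move=> e0 hc.
set S := \sum_(s : neset n | val s \subset t) c s.
pose y N := expR (N%:R * (entropy t - S + e)).
pose E N := [set w | (y N <= occupation_at t N w)%R].
suff : {ae P, forall w, \forall N \near \oo, ~ E N w}.
  by apply: filterS => w; apply: filterS => N /negP; rewrite -ltNge => /ltW.
apply: (@ae_eventually_not _ _ _ _ _ 1 (e / 2)) => //; first by rewrite divr_gt0.
have e20 : 0 < e / 2 by rewrite divr_gt0.
have hcall : \forall N \near \oo, forall s : neset n, val s \subset t ->
    hit_prob N s <= expR (- (N%:R * c s)).
  apply: filter_forall => s.
  case: (boolP (val s \subset t)) => st; last exact: nearW.
  by apply: filterS (hc s st).
have := block_entropy t e20.
move: hcall; apply: filterS3 (nbhs_infty_ge n) => N nN hs [_ hb]; split.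
  exact: (measurable_pattern (@measurable_hit_event N)
    (fun v => y N <= hits (anchored t) (bonds t) v)).
have y0 : 0 < y N by exact: expR_gt0.
apply: (le_trans (hits_markov (@measurable_hit_event N) (hit_event_indep nN) _ _ y0)).
rewrite lee_fin sum_prod_bonds ler_pdivrMr// mul1r /y -expRD.
apply: (@le_trans _ _ (expR (N%:R * (entropy t + e / 2)) * expR (- (N%:R * S)))); last first.
  by rewrite -expRD ler_expR; lra.
apply: ler_pM => //.
  by apply: prodr_ge0 => s _; exact/fine_ge0.
rewrite /S mulr_sumr -sumrN expR_sum; apply: ler_prod => s st.
by rewrite hs// andbT; exact/fine_ge0.
Qed.

(** Chebyshev at half the mean.  By [relative_variance_le] the relative variance is
    a sum over nonempty [t] of terms decaying like
    [exp (- N (entropy t - \sum c))], and [e] is a common gap between the two. *)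
Lemma occupation_ge (c : neset n -> R) (e : R) : 0 < e ->
  (forall s : neset n, \forall N \near \oo, expR (- (N%:R * c s)) <= hit_prob N s) ->
  (forall t : {set 'I_n}, t != finset.set0 ->
     \sum_(s : neset n | val s \subset t) c s + e <= entropy t) ->
  {ae P, forall w, \forall N \near \oo,
    expR (N%:R * (ln 2 - \sum_s c s)) / 2 <= occupation_at finset.setT N w}.
Proof.
move=> e0 hc hgap.
pose m N := 2 ^+ block_size (k N) finset.setT * \prod_s hit_prob N s.
pose E N := [set w | (occupation_at finset.setT N w <= m N / 2)%R].
have e20 : 0 < e / 2 by rewrite divr_gt0.
have hcall : \forall N \near \oo, forall s : neset n, expR (- (N%:R * c s)) <= hit_prob N s.
  exact: filter_forall.
have : {ae P, forall w, \forall N \near \oo, ~ E N w}.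
  pose C : R := 4 * #|[pred t : {set 'I_n} | t != finset.set0]|%:R.
  apply: (@ae_eventually_not _ _ _ _ _ C (e / 2)) => //.
    by rewrite mulr_ge0.
  have hball : \forall N \near \oo, forall t : {set 'I_n},
      expR (N%:R * (entropy t - e / 2)) <= 2 ^+ block_size (k N) t :> R.
    by apply: filter_forall => t; apply: filterS (block_entropy t e20) => N [].
  move: (hcall) hball; apply: filterS3 (nbhs_infty_ge n) => N nN hs hb; split.
    exact: (measurable_pattern (@measurable_hit_event N)
      (fun v => hits (anchored finset.setT) (bonds finset.setT) v <= m N / 2)).
  have q0 s : 0 < hit_prob N s by apply: lt_le_trans (hs s); exact: expR_gt0.
  have m0 : 0 < m N by rewrite mulr_gt0 ?exprn_gt0// prodr_gt0.
  have ancT (sigma : config (k N)) : anchored finset.setT sigma.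
    by rewrite /anchored finset.setCT finset.sub0set.
  have mE : m N = \sum_(sigma : config (k N) | anchored finset.setT sigma)
      \prod_(u in bonds finset.setT sigma) hit_prob N (tag u).
    rewrite sum_prod_bonds; congr (_ * _).
    by apply: eq_bigl => s; rewrite finset.subsetT.
  apply: (le_trans (hits_chebyshev (@measurable_hit_event N) (hit_event_indep nN) mE m0)).
  rewrite lee_fin /C -mulrA ler_pM2l//.
  under eq_bigl do rewrite ancT.
  under eq_bigr => sigma _ do under eq_bigl do rewrite ancT.
  apply: (le_trans (relative_variance_le _ q0)).
  rewrite mulr_natl -sumr_const; apply: ler_sum => t t0.
  rewrite -[leRHS]invrK lef_pV2 ?posrE ?invr_gt0 ?expR_gt0//; last first.
    by rewrite mulr_gt0 ?exprn_gt0// prodr_gt0.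
  rewrite expRN invrK.
  apply: (@le_trans _ _ (expR (N%:R * (entropy t - e / 2)) *
      expR (- (N%:R * \sum_(s : neset n | val s \subset t) c s)))).
    rewrite -expRD ler_expR; have := hgap t t0.
    have : 0 <= N%:R :> R by []. 
    by nra.
  apply: ler_pM; rewrite ?expR_ge0//.
  rewrite mulr_sumr -sumrN expR_sum; apply: ler_prod => s _.
  by rewrite expR_ge0 hs.
apply: filterS => w; move: hcall; apply: filterS3 (nbhs_infty_ge n) => N nN hs /negP.
rewrite -ltNge => /ltW; apply: le_trans.
rewrite ler_pM2r ?invr_gt0// /m mulrBr expRD.
apply: ler_pM; rewrite ?expR_ge0//.
  rewrite -[2 ^+ _ : R](@lnK R) ?posrE ?exprn_gt0// lnXn// ler_expR.
  rewrite mulr_natl /block_size (eq_bigl xpredT) => [|i]; last by rewrite inE.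
  by rewrite hksum.
rewrite mulr_sumr -sumrN expR_sum; apply: ler_prod => s _.
by rewrite expR_ge0 hs.
Qed.

End Occupation.

(** * Consequences of the large deviation principle *)
Section RateFunctions.
Context {R : realType}.
Local Open Scope ereal_scope.

Lemma LDP_upper_exp (nu : nat -> probability R R) (J : R -> \bar R) (B : set R) (c : R) :
  LDP nu J -> measurable B -> c%:E < ereal_inf (J @` closure B) ->
  \forall N \near \oo, (fine (nu N B) <= expR (- (N%:R * c)))%R.
Proof.
move=> [_ _ hL] mB cI; have [_ _ hU] := hL B mB.
have : limn_esup (fun N => (N%:R^-1)%:E * lne (nu N B)) < (- c)%:E.
  by apply: (le_lt_trans hU); rewrite EFinN lteN2.
move=> /ereal_inf_lt[_ [V Vinf <-] Vc].
move: (nbhs_infty_gt 0) Vinf; apply: filterS2 => N N0 VN.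
have : (N%:R^-1)%:E * lne (nu N B) < (- c)%:E.
  by apply: le_lt_trans Vc; apply: ereal_sup_ubound; exists N.
have N0' : (0 < N%:R :> R)%R by rewrite ltr0n.
have [r r0 ->] : exists2 r : R, (0 <= r)%R & nu N B = r%:E.
  by exists (fine (nu N B)); [exact/fine_ge0|rewrite fineK// fin_num_measure].
rewrite [fine _]/=; move: r0; rewrite le_eqVlt => /predU1P[<- _|r0].
  exact: expR_ge0.
rewrite lne_EFin// -EFinM lte_fin => h.
rewrite -(@lnK R r)// ler_expR; move: h; rewrite mulrC ltr_pdivrMr// => h.
by apply/ltW; lra.
Qed.

Lemma LDP_lower_exp (nu : nat -> probability R R) (J : R -> \bar R) (B : set R) (c : R) :
  LDP nu J -> measurable B -> ereal_inf (J @` B°) < c%:E ->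
  \forall N \near \oo, (expR (- (N%:R * c)) <= fine (nu N B))%R.
Proof.
move=> [_ _ hL] mB cI; have [hU _ _] := hL B mB.
have : limn_esup (\- (fun N => (N%:R^-1)%:E * lne (nu N B))) < c%:E.
  by apply: le_lt_trans cI; rewrite -leeN2.
move=> /ereal_inf_lt[_ [V Vinf <-] Vc].
move: (nbhs_infty_gt 0) Vinf; apply: filterS2 => N N0 VN.
have : - ((N%:R^-1)%:E * lne (nu N B)) < c%:E.
  by apply: le_lt_trans Vc; apply: ereal_sup_ubound; exists N.
have N0' : (0 < N%:R :> R)%R by rewrite ltr0n.
have [r r0 ->] : exists2 r : R, (0 <= r)%R & nu N B = r%:E.
  by exists (fine (nu N B)); [exact/fine_ge0|rewrite fineK// fin_num_measure].
rewrite [fine _]/=; move: r0; rewrite le_eqVlt => /predU1P[<-|r0].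
  by rewrite /lne lexx gt0_muleNy// lte_fin invr_gt0.
rewrite lne_EFin// -EFinM -EFinN lte_fin => h.
rewrite -(@lnK R r)// ler_expR; move: h; rewrite -mulrN mulrC ltr_pdivrMr// => h.
by apply/ltW; lra.
Qed.

(** The sets of points of [F] that are minimal up to [1 / j.+1] are compact, nested
    and nonempty, and a common point is a minimiser. *)
Lemma good_rate_attained (J : R -> \bar R) (F : set R) :
  (forall x, 0 <= J x) -> good_rate J -> closed F -> ereal_inf (J @` F) < +oo ->
  exists2 x, F x & J x = ereal_inf (J @` F).
Proof.
move=> J0 gJ cF Ioo; set I := ereal_inf _ in Ioo *.
have I0 : 0 <= I by apply: le_ereal_inf_tmp => _ [x _ <-].
have Ifin : I \is a fin_num by rewrite ge0_fin_numE.
have hy j : exists x, F x /\ J x <= I + (j.+1%:R^-1)%:E.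
  have /ereal_inf_lt[_ [x Fx <-] /ltW] : I < I + (j.+1%:R^-1)%:E.
    by rewrite lteDl// lte_fin invr_gt0.
  by exists x.
have [y yP] := choice hy.
have IE : I = (fine I)%:E by rewrite fineK.
pose K j : set R := F `&` [set x | J x <= I + (j.+1%:R^-1)%:E].
have cK j : compact (K j).
  rewrite /K setIC; apply: compact_closedI => //.
  by rewrite IE -EFinD; exact: gJ.
have Ktail j : \forall i \near \oo, K j (y i).
  exists j => // i /= ji; split; first by have [] := yP i.
  have [_ /le_trans] := yP i; apply; rewrite leeD2l// lee_fin.
  by rewrite lef_pV2 ?posrE ?ltr0n// ler_nat.
have [x [K0x clx]] := cK 0%N (y @ \oo) _ (Ktail 0%N).
have Kx j : K j x.
  have /closure_id -> : closed (K j) by apply: compact_closed => //; exact: Rhausdorff.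
  by move=> V Vx; apply: clx => //; exact: Ktail.
exists x; first by have [] := K0x.
apply/eqP; rewrite eq_le; apply/andP; split; last first.
  by apply: ereal_inf_lbound; exists x => //; case: K0x.
apply/lee_addgt0Pr => e e0.
have [j _ hj] := near_infty_natSinv_lt (PosNum e0).
have [_ /le_trans] := Kx j; apply; rewrite leeD2l// lee_fin ltW//.
exact: (hj j (leqnn j)).
Qed.

(** If the infimum of [J] were positive, the upper bound would make the total mass
    exponentially small. *)
Lemma LDP_zero (nu : nat -> probability R R) (J : R -> \bar R) :
  LDP nu J -> good_rate J -> exists x, J x = 0.
Proof.
move=> hL gJ; have [J0 _ _] := hL.
have I0 : 0 <= ereal_inf (J @` setT) by apply: le_ereal_inf_tmp => _ [x _ <-].
have Ile : ereal_inf (J @` setT) <= 0.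
  rewrite leNgt; apply/negP => Ipos.
  have [c c0 cI] : exists2 c : R, (0 < c)%R & c%:E < ereal_inf (J @` setT).
    move: Ipos; case: ereal_inf => [r| |]//.
      by rewrite lte_fin => r0; exists (r / 2)%R; rewrite ?divr_gt0// lte_fin; lra.
    by move=> _; exists 1%R; rewrite ?ltry.
  rewrite -closureT in cI.
  have := LDP_upper_exp hL measurableT cI.
  move=> /(filterI (nbhs_infty_gt 0)) /filter_ex[N [N0]].
  rewrite probability_setT /= -[leLHS]expR0 ler_expR oppr_ge0 leNgt mulr_gt0//.
  by rewrite ltr0n.
have [|x _ Jx] := good_rate_attained J0 gJ (@closedT R).
  exact: le_lt_trans Ile (ltry 0).
by exists x; apply/eqP; rewrite Jx eq_le Ile I0.
Qed.

Lemma good_rate_coercive (J : R -> \bar R) (a : R) : good_rate J ->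
  exists M : R, forall x, (M <= `|x|)%R -> a%:E < J x.
Proof.
move=> /(_ a) /compact_bounded[M [_ hM]].
exists (M + 2)%R => x Mx; rewrite ltNge; apply/negP => Jx.
have : (`|x| <= M + 1)%R by apply: (hM (M + 1)%R) => //; rewrite ltrDl.
lra.
Qed.

End RateFunctions.

(** * A countable grid and bounds on the partition function *)
Section Cells.
Context {R : realType}.

Definition mesh (m : nat) : R := m.+1%:R^-1.

Lemma mesh_gt0 m : 0 < mesh m.
Proof. by rewrite invr_gt0 ltr0n. Qed.

Lemma mesh_le1 m : mesh m <= 1.
Proof. by rewrite /mesh invf_le1 ?ltr0n// ler1n. Qed.

Lemma mesh_small (e : R) : 0 < e -> \forall m \near \oo, mesh m < e.
Proof. by move=> e0; exact: near_infty_natSinv_lt (PosNum e0). Qed.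

(** The open cells overlap, so that every real number is an interior point of one
    of them: the same cells serve for the lower bound, which uses interiors, and
    for the upper bound, which uses closures. *)
Definition cell (m : nat) (z : int) : set R :=
  [set` `](z%:~R - 1) * mesh m, (z%:~R + 1) * mesh m[].

Lemma open_cell m z : open (cell m z).
Proof. exact: interval_open. Qed.

Lemma measurable_cell m z : measurable (cell m z).
Proof. exact: measurable_itv. Qed.

Lemma cellP m z x : cell m z x ->
  (z%:~R - 1) * mesh m <= x <= (z%:~R + 1) * mesh m.
Proof. by rewrite /cell /= in_itv/= => /andP[/ltW -> /ltW ->]. Qed.

Lemma closure_cell m z x : closure (cell m z) x ->
  (z%:~R - 1) * mesh m <= x <= (z%:~R + 1) * mesh m.
Proof.
have cl : closed [set` `[(z%:~R - 1) * mesh m : R, (z%:~R + 1) * mesh m]].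
  exact: interval_closed.
move=> clx; suff : [set` `[(z%:~R - 1) * mesh m : R, (z%:~R + 1) * mesh m]] x.
  by rewrite /= in_itv.
move/closure_id: cl => ->; apply: closureS clx => y /cellP.
by rewrite /= in_itv.
Qed.

Lemma cell_floor m x : cell m (Num.floor (x * m.+1%:R)) x.
Proof.
have m0 : 0 < m.+1%:R :> R by rewrite ltr0n.
rewrite /cell /= in_itv/= /mesh ltr_pdivrMr// ltr_pdivlMr//.
have := floor_le (x * m.+1%:R); have := floorD1_gt (x * m.+1%:R).
by rewrite intrD => h1 h2; apply/andP; split; lra.
Qed.

End Cells.

Arguments mesh {R} m.

Section PartitionBounds.
Context {R : realType} (n : nat) (k : 'I_n -> nat) (a : neset n -> R) (N : nat).
Variables (x : forall s : neset n, subconfig k s -> R) (beta : R).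
Arguments x : clear implicits.
Hypothesis ha : forall s, 0 <= a s.
Hypothesis beta0 : 0 <= beta.

Lemma boltzmannE (sigma : config k) :
  expR (- beta * hamiltonian a N x sigma) =
  expR (- (N%:R * \sum_s beta * a s * x s (proj_config s sigma))).
Proof.
rewrite /hamiltonian mulNr mulrCA; congr (expR (- (_ * _))).
by rewrite mulr_sumr; apply: eq_bigr => s _; rewrite mulrA.
Qed.

Lemma occupationT (B : neset n -> set R) :
  occupation x B finset.setT =
  \sum_(sigma : config k) (bonds finset.setT sigma \subset occupied x B)%:R.
Proof.
rewrite /occupation /hits; apply: eq_bigl => sigma.
by rewrite /anchored finset.setCT finset.sub0set.
Qed.

Lemma partition_ge (B : neset n -> set R) (u : neset n -> R) :
  (forall s y, B s y -> y <= u s) ->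
  occupation x B finset.setT * expR (- (N%:R * \sum_s beta * a s * u s)) <=
  partition_function a N x beta.
Proof.
move=> hu; rewrite occupationT mulr_suml; apply: ler_sum => sigma _.
rewrite boltzmannE; case: bonds_subset_occupied => [h|_]; last by rewrite mul0r expR_ge0.
rewrite mul1r ler_expR lerN2 ler_wpM2l// ler_sum// => s _.
by rewrite ler_wpM2l ?mulr_ge0//; apply: hu; apply: h; rewrite finset.subsetT.
Qed.

Lemma partition_le (I : finType) (B : I -> neset n -> set R) (l : I -> neset n -> R) :
  (forall i s y, B i s y -> l i s <= y) ->
  (forall sigma, exists i, forall s, B i s (x s (proj_config s sigma))) ->
  partition_function a N x beta <=
  \sum_i occupation x (B i) finset.setT * expR (- (N%:R * \sum_s beta * a s * l i s)).
Proof.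
move=> hl hcov.
under [leRHS]eq_bigr do rewrite occupationT mulr_suml.
rewrite [leRHS]exchange_big; apply: ler_sum => sigma _ /=.
have [i hi] := hcov sigma.
rewrite (bigD1 i)//= boltzmannE -[leLHS]addr0 lerD//.
  case: bonds_subset_occupied => [h|[]]; last by move=> s _; exact: hi.
  rewrite mul1r ler_expR lerN2 ler_wpM2l// ler_sum// => s _.
  by rewrite ler_wpM2l ?mulr_ge0//; apply: hl; apply: h; rewrite finset.subsetT.
by apply: sumr_ge0 => j _; rewrite mulr_ge0 ?expR_ge0.
Qed.

(** Occupation numbers are integers, so one below 1 vanishes; and a configuration in
    the box has its restriction to [t] in the box. *)
Lemma occupationT_eq0 (B : neset n -> set R) (t : {set 'I_n}) :
  occupation x B t < 1 -> occupation x B finset.setT = 0.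
Proof.
move=> h; rewrite occupationT big1// => sigma _.
case: bonds_subset_occupied => // hs; exfalso; move: h; apply/negP; rewrite -leNgt.
by apply: (@occupation_ge1 _ _ _ _ _ _ sigma) => s _; apply: hs; rewrite finset.subsetT.
Qed.

End PartitionBounds.

(** * The free energy of a typical realisation *)
Section TypicalRealisation.
Context {R : realType} (n : nat) (k : nat -> 'I_n -> nat) (p : 'I_n -> R).
Variables (a : neset n -> R) (J : neset n -> R -> \bar R) (beta : R).
Variable X : forall N (s : neset n), subconfig (k N) s -> R.
Arguments X : clear implicits.
Hypothesis ha : forall s, 0 <= a s.
Hypothesis beta0 : 0 <= beta.
Hypothesis J0 : forall s x, (0 <= J s x)%E.
Hypothesis hgood : forall s, good_rate (J s).
Hypothesis entT : entropy p finset.setT = ln 2.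

(** A real number below [I], tending to [I] as [l] grows, also when [I] is
    infinite.  The index
    [l] makes the family of almost sure upper bounds countable. *)
Definition upper_cost (l : nat) (I : \bar R) : R :=
  if I == +oo%E then l%:R else fine I - mesh l.

Definition lower_cost (l : nat) (I : \bar R) : R := fine I + mesh l.

Lemma upper_cost_lt l I : (0 <= I)%E -> ((upper_cost l I)%:E < I)%E.
Proof.
rewrite /upper_cost; case: I => [r| |]//= _; last exact: ltry.
by rewrite lte_fin ltrBlDr ltrDl mesh_gt0.
Qed.

Lemma upper_cost_geN1 l I : (0 <= I)%E -> -1 <= upper_cost l I.
Proof.
rewrite /upper_cost; case: ifP => // _ /fine_ge0 I0.
  by rewrite (le_trans (lerN10 R)).
have := @mesh_le1 R l.
lra.
Qed.

Local Notation grid := {ffun neset n -> int}.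
Local Notation cells m z := (fun s => cell m (z s)).
Local Notation closed_inf m z s := (ereal_inf (J s @` closure (cell m (z s)))).
Local Notation open_inf m z s := (ereal_inf (J s @` (cell m (z s))°)).

Lemma expR_small (c : R) : 0 < c -> forall e, 0 < e ->
  \forall N \near \oo, c <= expR (N%:R * e).
Proof.
move=> c0 e e0.
near=> N.
rewrite -[leLHS](@lnK R)// ler_expR -ler_pdivrMr// ltW//.
by near: N; exact: nbhs_infty_gtr.
Unshelve. all: by end_near. Qed.

Section UpperBound.
Hypothesis hU : forall m (z : grid) l (t : {set 'I_n}), \forall N \near \oo,
  occupation (X N) (cells m z) t <= expR (N%:R * (entropy p t -
    \sum_(s : neset n | val s \subset t) upper_cost l (closed_inf m z s) + mesh l)).

Let closed_inf_ge0 m (z : grid) s : (0 <= closed_inf m z s)%E.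
Proof. by apply: le_ereal_inf_tmp => _ [x _ <-]. Qed.

Lemma occupation_eventually0 m (z : grid) l (t : {set 'I_n}) :
  entropy p t - \sum_(s : neset n | val s \subset t) upper_cost l (closed_inf m z s)
    + mesh l < 0 ->
  \forall N \near \oo, occupation (X N) (cells m z) finset.setT = 0.
Proof.
move=> neg; have := hU m z l t; apply: filterS2 (nbhs_infty_gt 0) => N N0 hN.
apply: (@occupationT_eq0 _ _ _ _ _ t); apply: (le_lt_trans hN).
by rewrite -[ltRHS]expR0 ltr_expR pmulr_rlt0// ltr0n.
Qed.

(** The dichotomy behind the set [Psi].  Let [r s] be the infimum of [J s] on the
    closed cell.  If [r] violates one of the inequalities defining [Psi], or is
    infinite, the box is eventually empty by the first moment on the offending
    [t]; otherwise the minimisers form a point of [Psi] with costs [r]. *)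
Lemma occupied_cells m (z : grid) :
  (\forall N \near \oo, occupation (X N) (cells m z) finset.setT = 0) \/
  exists x r : neset n -> R, [/\ Psi p J x,
    forall s, closure (cell m (z s)) (x s),
    forall s, J s (x s) = (r s)%:E &
    forall e, 0 < e -> \forall N \near \oo,
      occupation (X N) (cells m z) finset.setT <=
      expR (N%:R * (ln 2 - \sum_s r s + e))].
Proof.
pose c : R := #|{: neset n}|%:R.
have [[s sI]|allfin] := pselect (exists s, closed_inf m z s = +oo%E).
  (* The other costs are at least -1, so the cost [l] of [s] dominates them. *)
  left; pose t := val s.
  have [l lP] : exists l : nat, entropy p t + c + 1 < l%:R.
    by have /filter_ex[l lP] := nbhs_infty_gtr (entropy p t + c + 1); exists l.
  apply: (@occupation_eventually0 _ _ l t).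
  rewrite (bigD1 s)//= {1}/upper_cost sI eqxx.
  have : - c <= \sum_(i : neset n | (val i \subset t) && (i != s))
      upper_cost l (closed_inf m z i).
    apply: (@le_trans _ _ (\sum_(i : neset n | (val i \subset t) && (i != s)) (-1))).
      rewrite sumr_const mulNrn lerN2 /c ler_nat; exact: max_card.
    by apply: ler_sum => i _; exact: upper_cost_geN1.
  have := @mesh_le1 R l.
  lra.
have fin s : closed_inf m z s \is a fin_num.
  rewrite ge0_fin_numE// ltey; apply/eqP => e; apply: allfin; by exists s.
pose r s := fine (closed_inf m z s).
have rE s : closed_inf m z s = (r s)%:E by rewrite fineK.
have costE l s : upper_cost l (closed_inf m z s) = r s - mesh l.
  by rewrite /upper_cost rE.
have sum_cost l (t : {set 'I_n}) :
    \sum_(s : neset n | val s \subset t) r s - c * mesh l <=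
    \sum_(s : neset n | val s \subset t) upper_cost l (closed_inf m z s).
  under [leRHS]eq_bigr do rewrite costE.
  rewrite sumrB lerD2l lerN2 sumr_const -[leLHS]mulr_natl.
  apply: ler_wpM2r; first exact/ltW/mesh_gt0.
  by rewrite /c ler_nat; exact: max_card.
have c1 : 0 < c + 1 by rewrite ltr_wpDl.
have [[t tP]|hPsi] := pselect (exists t : {set 'I_n},
    entropy p t < \sum_(s : neset n | val s \subset t) r s).
  left.
  have g0 : 0 < (\sum_(s : neset n | val s \subset t) r s - entropy p t) / (c + 1).
    by rewrite divr_gt0 ?subr_gt0.
  have /filter_ex[l] := mesh_small g0.
  rewrite ltr_pdivlMr// => lP.
  apply: (@occupation_eventually0 _ _ l t).
  have := sum_cost l t; lra.
right.
have /choice[x xP] : forall s, exists x, closure (cell m (z s)) x /\ J s x = (r s)%:E.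
  move=> s; have [|x clx Jx] := good_rate_attained (J0 s) (hgood (s := s))
    (@closed_closure _ (cell m (z s))).
    by rewrite rE ltry.
  by exists x; rewrite -rE.
exists x, r; split.
- move=> t; under eq_bigr => s _ do rewrite (xP s).2.
  rewrite sumEFin lee_fin leNgt; apply/negP => h; apply: hPsi; by exists (val t).
- by move=> s; exact: (xP s).1.
- by move=> s; exact: (xP s).2.
- move=> e e0.
  have g0 : 0 < e / (c + 1) by rewrite divr_gt0.
  have /filter_ex[l] := mesh_small g0.
  rewrite ltr_pdivlMr// => lP.
  have := hU m z l finset.setT; apply: filterS => N /le_trans; apply.
  rewrite ler_expR ler_wpM2l// entT.
  have := sum_cost l finset.setT.
  have -> : \sum_(s : neset n | val s \subset finset.setT) r s = \sum_s r s.
    by apply: eq_bigl => s; rewrite finset.subsetT.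
  lra.
Qed.

Variable M : R.
Hypothesis hM : \forall N \near \oo, forall (s : neset n) (sigma : config (k N)),
  `|X N s (proj_config s sigma)| <= M.

(** A finite index type for the grid points with coordinates between [- K]
    and [K]. *)
Definition shifted_grid (K : nat) (i : {ffun neset n -> 'I_(K + K).+1}) : grid :=
  [ffun s => (i s)%:Z - K%:Z].

Lemma shifted_grid_cover m (K : nat) (y : neset n -> R) :
  (forall s, `|y s| * m.+1%:R < K%:R) ->
  exists i, forall s, cell m (@shifted_grid K i s) (y s).
Proof.
move=> hy; pose f s := Num.floor (y s * m.+1%:R).
have hf s : - K%:Z <= f s < K%:Z.
  have := hy s; rewrite -[_.+1%:R in X in X -> _]ger0_norm// -normrM => /ltr_normlP[h1 h2].
  rewrite /f floor_ge_int floor_lt_int mulrNz /= h2 andbT; lra.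
exists [ffun s => inord (absz (f s + K%:Z)%R)] => s.
rewrite /shifted_grid !ffunE inordK; last by have := hf s; lia.
rewrite gez0_abs; last by have := hf s; lia.
by rewrite addrK; exact: cell_floor.
Qed.

(** Each box is either empty or contributes at most [exp (N (ln 2 - v))] up to a
    small error, and there are finitely many boxes. *)
Lemma partition_upper (v e : R) : 0 < e ->
  (forall x r : neset n -> R, Psi p J x -> (forall s, J s (x s) = (r s)%:E) ->
     v <= \sum_s (beta * a s * x s + r s)) ->
  \forall N \near \oo,
    partition_function a N (X N) beta <= expR (N%:R * (ln 2 - v + e)).
Proof.
move=> e0 hv.
pose A := \sum_s beta * a s.
have A0 : 0 <= A by apply: sumr_ge0 => s _; rewrite mulr_ge0.
have e4 : 0 < e / 4 by rewrite divr_gt0.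
have [m mP] : exists m, A * (2 * mesh m) < e / 4.
  have /filter_ex[m mP] : \forall m \near \oo, mesh m < e / 4 / (2 * A + 1).
    by apply: mesh_small; rewrite divr_gt0// ltr_wpDl// mulr_ge0.
  exists m; move: mP; rewrite ltr_pdivlMr ?ltr_wpDl ?mulr_ge0//.
  by have := @mesh_gt0 R m; nra.
have [K KM] : exists K : nat, M * m.+1%:R < K%:R.
  by have /filter_ex[K KP] := nbhs_infty_gtr (M * m.+1%:R); exists K.
pose B (i : {ffun neset n -> 'I_(K + K).+1}) s := cell m (shifted_grid i s) : set R.
pose lo (i : {ffun neset n -> 'I_(K + K).+1}) s : R := ((shifted_grid i s)%:~R - 1) * mesh m.
have term (i : {ffun neset n -> 'I_(K + K).+1}) : \forall N \near \oo,
    occupation (X N) (B i) finset.setT * expR (- (N%:R * \sum_s beta * a s * lo i s)) <=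
    expR (N%:R * (ln 2 - v + e / 2)).
  have [h0|[x [r [xPsi xcl Jx hx]]]] := occupied_cells m (shifted_grid i).
    by apply: filterS h0 => N; rewrite /B => ->; rewrite mul0r expR_ge0.
  have := hx _ e4; apply: filterS => N hN.
  apply: (@le_trans _ _ (expR (N%:R * (ln 2 - \sum_s r s + e / 4)) *
      expR (- (N%:R * \sum_s beta * a s * lo i s)))).
    by rewrite ler_wpM2r ?expR_ge0.
  rewrite -expRD ler_expR -mulrN -mulrDr ler_wpM2l//.
  have := hv x r xPsi Jx; rewrite big_split /=.
  have : \sum_s beta * a s * x s - A * (2 * mesh m) <= \sum_s beta * a s * lo i s.
    rewrite /A mulr_suml -sumrB; apply: ler_sum => s _.
    rewrite -mulrBr ler_wpM2l ?mulr_ge0//.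
    by have := closure_cell (xcl s); rewrite /lo => /andP[_]; lra.
  lra.
have termall : \forall N \near \oo, forall i : {ffun neset n -> 'I_(K + K).+1},
    occupation (X N) (B i) finset.setT * expR (- (N%:R * \sum_s beta * a s * lo i s)) <=
    expR (N%:R * (ln 2 - v + e / 2)).
  exact: filter_forall.
pose C : R := #|{: {ffun neset n -> 'I_(K + K).+1}}|%:R.
have C0 : 0 < C by rewrite ltr0n; apply/card_gt0P; exists [ffun=> ord0].
have e20 : 0 < e / 2 by rewrite divr_gt0.
move: termall (expR_small C0 e20); apply: filterS3 hM => N hMN hN hC.
have hcov (sigma : config (k N)) : exists i, forall s, B i s (X N s (proj_config s sigma)).
  have [|i hi] := @shifted_grid_cover m K (fun s => X N s (proj_config s sigma)); last by exists i.
  move=> s.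
  by apply: le_lt_trans KM; rewrite ler_wpM2r.
have hlo i s y : B i s y -> lo i s <= y by move=> /cellP/andP[].
have := @partition_le R n (k N) a N (X N) beta ha beta0 _ B lo hlo hcov.
move/le_trans; apply.
apply: (@le_trans _ _ (\sum_(i : {ffun neset n -> 'I_(K + K).+1})
    expR (N%:R * (ln 2 - v + e / 2)))).
  by apply: ler_sum => i _; exact: hN.
rewrite sumr_const -[leLHS]mulr_natl.
have -> : N%:R * (ln 2 - v + e) = N%:R * (e / 2) + N%:R * (ln 2 - v + e / 2) by lra.
by rewrite [leRHS]expRD ler_wpM2r ?expR_ge0.
Qed.

End UpperBound.

Section LowerBound.
Hypothesis hp : forall i, 0 < p i.
Hypothesis hconvex : forall s, convex_rate (J s).
Variable y : neset n -> R.
Hypothesis hy : forall s, J s (y s) = 0%E.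
Hypothesis hL : forall m (z : grid) l,
  (forall s, (open_inf m z s < +oo)%E) ->
  (forall t : {set 'I_n}, t != finset.set0 ->
     \sum_(s : neset n | val s \subset t) lower_cost l (open_inf m z s) + mesh l
     <= entropy p t) ->
  \forall N \near \oo, expR (N%:R * (ln 2 - \sum_s lower_cost l (open_inf m z s))) / 2 <=
    occupation (X N) (cells m z) finset.setT.

Let entropy_gt0 (t : {set 'I_n}) : t != finset.set0 -> 0 < entropy p t.
Proof.
move=> /finset.set0Pn[i it]; rewrite /entropy (bigD1 i)//= ltr_pwDl ?sumr_ge0//.
  by rewrite mulr_gt0// ln_gt0// ltr1n.
by move=> j _; rewrite mulr_ge0 ?ltW// ln_gt0// ltr1n.
Qed.

(** The point [x] of [Psi] is moved to [x' = (1 - theta) x + theta y].  As [y] has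
    cost zero, convexity brings every cost down to at most [1 - theta] times its value,
    which opens a gap [theta * entropy p t] in each inequality defining [Psi], while the energy
    changes by at most [theta * D]. *)
Lemma partition_lower (x r : neset n -> R) (e : R) : 0 < e ->
  Psi p J x -> (forall s, J s (x s) = (r s)%:E) ->
  \forall N \near \oo,
    expR (N%:R * (ln 2 - \sum_s (beta * a s * x s + r s) - e)) <=
    partition_function a N (X N) beta.
Proof.
move=> e0 xPsi Jx.
have e4 : 0 < e / 4 by rewrite divr_gt0.
pose c : R := #|{: neset n}|%:R.
have c1 : 0 < c + 1 by rewrite ltr_wpDl.
pose A := \sum_s beta * a s.
have A0 : 0 <= A by apply: sumr_ge0 => s _; rewrite mulr_ge0.
have r0 s : 0 <= r s by have := J0 s (x s); rewrite Jx lee_fin.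
pose D := `|\sum_s beta * a s * (y s - x s)|.
have D0 : 0 <= D by exact: normr_ge0.
have [theta [t0 t1 tD]] : exists theta : R, [/\ 0 < theta, theta < 1 & theta * D <= e / 4].
  (* Any positive value below 1 and at most e / (4 D) would do; this one needs no case split. *)
  exists (e / (4 * D + 4 + e)); have h : 0 < 4 * D + 4 + e by lra.
  split; first by rewrite divr_gt0.
    by rewrite ltr_pdivrMr//; lra.
  by rewrite mulrAC ler_pdivrMr//; nra.
pose x' s := (1 - theta) * x s + (1 - (1 - theta)) * y s.
have Jx' s : (J s (x' s) <= ((1 - theta) * r s)%:E)%E.
  have := @hconvex s (x s) (y s) (1 - theta); rewrite Jx hy mule0 adde0 -EFinM.
  by apply; lra.
have [m mP] : exists m, A * (2 * mesh m) < e / 4.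
  have /filter_ex[m mP] : \forall m \near \oo, mesh m < e / 4 / (2 * A + 1).
    by apply: mesh_small; rewrite divr_gt0// ltr_wpDl// mulr_ge0.
  exists m; move: mP; rewrite ltr_pdivlMr ?ltr_wpDl ?mulr_ge0//.
  by have := @mesh_gt0 R m; nra.
pose z : grid := [ffun s => Num.floor (x' s * m.+1%:R)].
have xcell s : cell m (z s) (x' s) by rewrite ffunE; exact: cell_floor.
have Ile s : (open_inf m z s <= ((1 - theta) * r s)%:E)%E.
  apply: le_trans (Jx' s); apply: ereal_inf_lbound; exists (x' s) => //.
  by have /interior_id -> := @open_cell R m (z s).
have costP l s : lower_cost l (open_inf m z s) <= (1 - theta) * r s + mesh l.
  have I0 : (0 <= open_inf m z s)%E by apply: le_ereal_inf_tmp => _ [u _ <-].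
  rewrite /lower_cost lerD2r -lee_fin fineK ?Ile//.
  by rewrite ge0_fin_numE// (le_lt_trans (Ile s))// ltry.
have sum_cost l (t : {set 'I_n}) :
    \sum_(s : neset n | val s \subset t) lower_cost l (open_inf m z s) <=
    (1 - theta) * \sum_(s : neset n | val s \subset t) r s + c * mesh l.
  apply: (@le_trans _ _ (\sum_(s : neset n | val s \subset t) ((1 - theta) * r s + mesh l))).
    by apply: ler_sum => s _.
  rewrite big_split /= -mulr_sumr lerD2l sumr_const -[leLHS]mulr_natl.
  apply: ler_wpM2r; first exact/ltW/mesh_gt0.
  by rewrite /c ler_nat; exact: max_card.
have [l [lP lgap]] : exists l, (c + 1) * mesh l < e / 4 /\
    forall t : {set 'I_n}, t != finset.set0 -> (c + 1) * mesh l < theta * entropy p t.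
  have small g : 0 < g -> \forall l \near \oo, (c + 1) * mesh l < g.
    move=> g0; have : 0 < g / (c + 1) by rewrite divr_gt0.
    move/mesh_small; apply: filterS => l; by rewrite ltr_pdivlMr// mulrC.
  have allt : \forall l \near \oo, forall t : {set 'I_n}, t != finset.set0 ->
      (c + 1) * mesh l < theta * entropy p t.
    apply: filter_forall => t; case: (boolP (t == finset.set0)) => [_|tn0].
      exact: nearW.
    have g0 : 0 < theta * entropy p t by rewrite mulr_gt0// entropy_gt0.
    by apply: filterS (small _ g0) => l hl _.
  have /filter_ex[l [h1 h2]] : \forall l \near \oo, (c + 1) * mesh l < e / 4 /\
      forall t : {set 'I_n}, t != finset.set0 -> (c + 1) * mesh l < theta * entropy p t.
    exact: filterI (small _ e4) allt.
  by exists l.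
have l0 := @mesh_gt0 R l.
have c0 : 0 <= c by [].
have occ := @hL m z l _ _.
have {occ} : \forall N \near \oo,
    expR (N%:R * (ln 2 - \sum_s lower_cost l (open_inf m z s))) / 2 <=
    occupation (X N) (cells m z) finset.setT.
  apply: occ => [s|t tn0]; first by rewrite (le_lt_trans (Ile s))// ltry.
  have := sum_cost l t; have := lgap t tn0.
  have := xPsi (Sub t tn0); rewrite /=.
  under eq_bigr do rewrite Jx.
  rewrite sumEFin lee_fin -/(entropy p t).
  by have := entropy_gt0 tn0; nra.
have two0 : 0 < 2 :> R by [].
move: (expR_small two0 e4); apply: filterS2 => N h2 hocc.
pose u s : R := ((z s)%:~R + 1) * mesh m.
have hu s v : cell m (z s) v -> v <= u s by move=> /cellP/andP[].
have := @partition_ge R n (k N) a N (X N) beta ha beta0 _ u hu.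
apply: le_trans.
apply: (@le_trans _ _ (expR (N%:R * (ln 2 - \sum_s lower_cost l (open_inf m z s))) / 2 *
    expR (- (N%:R * \sum_s beta * a s * u s)))); last by rewrite ler_wpM2r ?expR_ge0.
rewrite mulrAC ler_pdivlMr// -expRD.
apply: (@le_trans _ _ (expR (N%:R * (ln 2 - \sum_s (beta * a s * x s + r s) - e)) *
    expR (N%:R * (e / 4)))); first by rewrite ler_wpM2l ?expR_ge0.
rewrite -expRD ler_expR -mulrN -!mulrDr ler_wpM2l//.
have sumu : \sum_s beta * a s * u s <= \sum_s beta * a s * x' s + A * (2 * mesh m).
  rewrite /A mulr_suml -big_split; apply: ler_sum => s _ /=.
  rewrite -mulrDr ler_wpM2l ?mulr_ge0//.
  by have /cellP/andP[] := xcell s; rewrite /u; lra.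
have sumx' : \sum_s beta * a s * x' s <= \sum_s beta * a s * x s + theta * D.
  apply: (@le_trans _ _ (\sum_s beta * a s * x s + theta * \sum_s beta * a s * (y s - x s))).
    rewrite mulr_sumr -big_split /=; apply: ler_sum => s _.
    by rewrite /x'; lra.
  by rewrite lerD2l ler_wpM2l ?ler_norm// ltW.
have := sum_cost l finset.setT.
have allT (f : neset n -> R) : \sum_(s : neset n | val s \subset finset.setT) f s = \sum_s f s.
  by apply: eq_bigl => s; rewrite finset.subsetT.
rewrite !allT.
have -> : \sum_s (beta * a s * x s + r s) = \sum_s beta * a s * x s + \sum_s r s.
  by rewrite big_split.
have : 0 <= theta * \sum_s r s by rewrite mulr_ge0 ?sumr_ge0// ltW.
rewrite mulrBl mul1r; rewrite mulrDl mul1r in lP.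
lra.
Qed.

End LowerBound.
End TypicalRealisation.

Lemma Psi_rate_le (R : realType) (n : nat) (p : 'I_n -> R) (J : neset n -> R -> \bar R)
    (x : neset n -> R) (s : neset n) :
  (forall s x, (0 <= J s x)%E) -> Psi p J x -> (J s (x s) <= (entropy p (val s))%:E)%E.
Proof.
move=> J0 xPsi; apply: le_trans (xPsi s); rewrite (bigD1 s)//= leeDl//.
by apply: sume_ge0 => i _.
Qed.

Lemma free_energy_cvg (R : realType) (Z : nat -> R) (v : R) :
  (forall e, 0 < e -> \forall N \near \oo, Z N <= expR (N%:R * (v + e))) ->
  (forall e, 0 < e -> \forall N \near \oo, expR (N%:R * (v - e)) <= Z N) ->
  (fun N => (N%:R^-1 * ln (Z N))%:E) @ \oo --> v%:E.
Proof.
move=> hup hlo; apply: cvg_EFin; first exact: nearW.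
apply/cvgrPdist_le => e e0.
move: (hup e e0) (hlo e e0); apply: filterS3 (nbhs_infty_gt 0) => N N0 h1 h2 /=.
have Z0 : 0 < Z N by apply: lt_le_trans h2; exact: expR_gt0.
have N0' : 0 < N%:R :> R by rewrite ltr0n.
move: h1 h2; rewrite -{1 2}(@lnK R (Z N))// !ler_expR => h1 h2.
rewrite ler_distlC mulrC ler_pdivlMr// ler_pdivrMr//.
by apply/andP; split; rewrite mulrC.
Qed.

Theorem theorem3p4p3 (R : realType) (n : nat) (hn : (1 <= n)%N)
  (k : nat -> 'I_n -> nat)
  (hk1 : forall N, (n <= N)%N -> forall i, (1 <= k N i)%N)
  (hksum : forall N, (n <= N)%N -> (\sum_(i < n) k N i)%N = N)
  (p : 'I_n -> R) (hp : forall i, 0 < p i)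
  (hkp : forall i, (fun N : nat => (k N i)%:R / N%:R : R) @ \oo --> p i)
  (a : neset n -> R) (ha : forall s, 0 <= a s)
  (lambda : neset n -> nat -> probability R R)
  (J : neset n -> R -> \bar R)
  (hLDP : forall s, LDP (lambda s) (J s))
  (hgood : forall s, good_rate (J s))
  (hconvex : forall s, convex_rate (J s))
  (d : measure_display) (T : measurableType d) (P : probability T R)
  (xi : forall (N : nat) (s : neset n), subconfig (k N) s -> {RV P >-> R})
  (hlaw : forall N, (n <= N)%N ->
     forall (s : neset n) (tau : subconfig (k N) s) (B : set R),
     measurable B -> distribution P (xi N s tau) B = lambda s N B)
  (hindep : forall N, (n <= N)%N ->
     mutually_independent
       (fun u : {s : neset n & subconfig (k N) s} =>
          xi N (tag u) (tagged u))) :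
  {ae P, forall w : T, forall beta : R, 0 < beta ->
     (fun N : nat =>
        ((N%:R)^-1 * ln (partition_function a N
                     (fun s tau => xi N s tau w) beta))%:E) @ \oo -->
     ((ln 2)%:E -
      ereal_inf [set (\sum_(s : neset n) ((beta * a s * x s)%:E + J s (x s)))%E
                | x in Psi p J])%E}.
Proof.
have J0 s x : (0 <= J s x)%E by have [] := hLDP s.
have entT := entropyT hksum hkp.
have /choice[y hy] : forall s, exists x, J s x = 0%E.
  by move=> s; exact: LDP_zero (hLDP s) (@hgood s).
have /choice[M hMs] : forall s, exists M : R, forall x, M <= `|x| ->
    ((entropy p (val s) + 2)%:E < J s x)%E.
  by move=> s; exact: good_rate_coercive.
have aeU : {ae P, forall w, forall i : nat * {ffun neset n -> int} * nat * {set 'I_n},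
    let: (m, z, l, t) := i in \forall N \near \oo,
    occupation (fun s tau => xi N s tau w) (fun s => cell m (z s)) t <=
    expR (N%:R * (entropy p t - \sum_(s : neset n | val s \subset t)
      upper_cost l (ereal_inf (J s @` closure (cell m (z s)))) + mesh l))}.
  apply: ae_forall_countable => -[[[m z] l] t].
  apply: (occupation_le hkp hlaw hindep (fun s => @measurable_cell R m (z s))).
    exact: mesh_gt0.
  move=> s _; apply: (LDP_upper_exp (hLDP s)); first exact: measurable_cell.
  by apply: upper_cost_lt; apply: le_ereal_inf_tmp => _ [x _ <-].
have aeL : {ae P, forall w, forall i : nat * {ffun neset n -> int} * nat,
    let: (m, z, l) := i in
    (forall s, (ereal_inf (J s @` (cell m (z s))°) < +oo)%E) ->
    (forall t : {set 'I_n}, t != finset.set0 ->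
       \sum_(s : neset n | val s \subset t)
         lower_cost l (ereal_inf (J s @` (cell m (z s))°)) + mesh l <= entropy p t) ->
    \forall N \near \oo, expR (N%:R * (ln 2 -
        \sum_s lower_cost l (ereal_inf (J s @` (cell m (z s))°)))) / 2 <=
      occupation (fun s tau => xi N s tau w) (fun s => cell m (z s)) finset.setT}.
  apply: ae_forall_countable => -[[m z] l].
  have [h1|nh] := pselect (forall s, (ereal_inf (J s @` (cell m (z s))°) < +oo)%E); last first.
    by apply: nearW => w /nh.
  have [h2|nh] := pselect (forall t : {set 'I_n}, t != finset.set0 ->
       \sum_(s : neset n | val s \subset t)
         lower_cost l (ereal_inf (J s @` (cell m (z s))°)) + mesh l <= entropy p t); last first.
    by apply: nearW => w _ /nh.
  have : {ae P, forall w, \forall N \near \oo, expR (N%:R * (ln 2 -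
        \sum_s lower_cost l (ereal_inf (J s @` (cell m (z s))°)))) / 2 <=
      occupation (fun s tau => xi N s tau w) (fun s => cell m (z s)) finset.setT}.
    apply: (occupation_ge hksum hkp hlaw hindep (fun s => @measurable_cell R m (z s))
      (mesh_gt0 l) _ h2).
    move=> s; apply: (LDP_lower_exp (hLDP s)); first exact: measurable_cell.
    have I0 : (0 <= ereal_inf (J s @` (cell m (z s))°))%E.
      by apply: le_ereal_inf_tmp => _ [x _ <-].
    by rewrite /lower_cost EFinD fineK ?ge0_fin_numE// lteDl ?lte_fin ?mesh_gt0// ge0_fin_numE.
  by apply: filterS => w hw _ _.
(* On the tail of [xi s] the rate exceeds the entropy of [val s] by 2, so the first
   moment over the restrictions to [val s], with no constraint on the other
   variables, leaves nothing there. *)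
have aeM : {ae P, forall w, forall s, \forall N \near \oo,
    forall sigma : config (k N), `|xi N s (proj_config s sigma) w| <= M s}.
  apply: ae_forall_countable => s.
  pose tail : set R := [set x | M s <= `|x|].
  have cl_tail : closed tail.
    apply: (preimage_closed _ (@closed_ge R (M s))) => x _; exact: norm_continuous.
  pose B s' : set R := if s' == s then tail else setT.
  have mB s' : measurable (B s').
    by rewrite /B; case: ifP => // _; exact: closed_measurable.
  pose c s' : R := if s' == s then entropy p (val s) + 1 else 0.
  have half0 : 0 < 2^-1 :> R by rewrite invr_gt0.
  have : {ae P, forall w, \forall N \near \oo,
      occupation (fun s tau => xi N s tau w) B (val s) <= expR (N%:R * (entropy p (val s) -
        \sum_(s' : neset n | val s' \subset val s) c s' + 2^-1))}.
    apply: (occupation_le hkp hlaw hindep mB half0) => s' _.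
    rewrite /c /hit_prob /B; case: eqP => [->|_]; last first.
      by apply: nearW => N; rewrite probability_setT /= mulr0 oppr0 expR0.
    apply: (LDP_upper_exp (hLDP s)); first exact: closed_measurable.
    move/closure_id: cl_tail => <-.
    apply: (@lt_le_trans _ _ (entropy p (val s) + 2)%:E); first by rewrite lte_fin; lra.
    by apply: le_ereal_inf_tmp => _ [x xtail <-]; exact/ltW/hMs.
  apply: filterS => w; apply: filterS2 (nbhs_infty_gt 0) => N N0 hN sigma.
  rewrite leNgt; apply/negP => /ltW tailw.
  have : 1 <= occupation (fun s tau => xi N s tau w) B (val s).
    apply: (@occupation_ge1 _ _ _ _ _ _ sigma) => s' _.
    by rewrite /B; case: eqP => [->|].
  apply/negP; rewrite -ltNge; apply: (le_lt_trans hN).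
  rewrite -[ltRHS]expR0 ltr_expR pmulr_rlt0 ?ltr0n//.
  have -> : \sum_(s' : neset n | val s' \subset val s) c s' = entropy p (val s) + 1.
    rewrite (bigD1 s)//= {1}/c eqxx big1 ?addr0// => s' /andP[_ /negbTE s's].
    by rewrite /c s's.
  lra.
move: aeU aeL aeM; apply: filterS3 => w hU hL hM beta beta0.
pose MM := \sum_s `|M s|.
have hMM : \forall N \near \oo, forall (s : neset n) (sigma : config (k N)),
    `|xi N s (proj_config s sigma) w| <= MM.
  have : \forall N \near \oo, forall (s : neset n) (sigma : config (k N)),
    `|xi N s (proj_config s sigma) w| <= M s by exact: filter_forall.
  apply: filterS => N h s sigma; apply: (le_trans (h s sigma)).
  by rewrite /MM (bigD1 s)//= (le_trans (ler_norm _))// lerDl sumr_ge0.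
set V := ereal_inf _.
have Phi_fin x : Psi p J x -> exists r : neset n -> R, forall s, J s (x s) = (r s)%:E.
  move=> xPsi; exists (fun s => fine (J s (x s))) => s; rewrite fineK//.
  by rewrite ge0_fin_numE// (le_lt_trans (Psi_rate_le s J0 xPsi))// ltry.
have PhiE x (r : neset n -> R) : (forall s, J s (x s) = (r s)%:E) ->
    (\sum_s ((beta * a s * x s)%:E + J s (x s)))%E =
    (\sum_s (beta * a s * x s + r s))%:E.
  by move=> xr; rewrite -sumEFin; apply: eq_bigr => s _; rewrite xr EFinD.
have yPsi : Psi p J y.
  move=> t; rewrite big1 => [|s _]; last exact: hy.
  by rewrite lee_fin sumr_ge0// => i _; rewrite mulr_ge0 ?ltW// ln_gt0// ltr1n.
have Vlt : (V < +oo)%E.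
  apply: (@le_lt_trans _ _ (\sum_s (beta * a s * y s + 0))%:E); last exact: ltry.
  by apply: ereal_inf_lbound; exists y => //; exact: PhiE.
have Vgt : (-oo < V)%E.
  apply: (@lt_le_trans _ _ (\sum_s (beta * a s * - M s))%:E); first exact: ltNyr.
  apply: le_ereal_inf_tmp => _ [x xPsi <-].
  have [r xr] := Phi_fin x xPsi; rewrite (PhiE x r xr) lee_fin.
  apply: ler_sum => s _.
  have r0 : 0 <= r s by rewrite -lee_fin -xr.
  rewrite -[leLHS]addr0 lerD//; apply: ler_wpM2l; first by rewrite mulr_ge0// ltW.
  have : `|x s| < M s.
    rewrite ltNge; apply/negP => /hMs; apply/negP; rewrite -leNgt.
    by apply: (le_trans (Psi_rate_le s J0 xPsi)); rewrite lee_fin; lra.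
  by move=> /ltr_normlP[h _]; rewrite lerNl ltW.
have VE : V = (fine V)%:E by rewrite fineK// fin_real// Vgt Vlt.
rewrite VE -EFinB; apply: free_energy_cvg => e e0.
  apply: (partition_upper ha (ltW beta0) J0 hgood entT _ hMM e0).
    by move=> m z l t; exact: (hU (m, z, l, t)).
  move=> x r xPsi xr; rewrite -lee_fin -VE -(PhiE x r xr).
  by apply: ereal_inf_lbound; exists x.
have e20 : 0 < e / 2 by rewrite divr_gt0.
have /ereal_inf_lt[_ [x xPsi <-] xV] : (V < V + (e / 2)%:E)%E.
  by rewrite {2}VE VE lte_fin ltrDl.
have [r xr] := Phi_fin x xPsi.
have hL' m (z : {ffun neset n -> int}) l := hL (m, z, l).
have := partition_lower ha (ltW beta0) J0 hp hconvex hy hL' e20 xPsi xr.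
apply: filterS => N; apply: le_trans; rewrite ler_expR ler_wpM2l//.
by move: xV; rewrite (PhiE x r xr) VE -EFinD lte_fin; lra.
Qed.
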